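(* Let $Q=(Q_0,Q_1)$ be a finite quiver with no sinks such that each vertex is the target of a path of length $\ge|Q_0|$, and let $V=(V_a)_{a\in Q_0}$ be a tuple of nonempty, finite, pairwise disjoint sets with $\overline V=\coprod_{a\in Q_0}V_a$. Let $\mathsf{EC}$ be the set of eventually constant set-valued representations of $Q$ on $V$, let $\overline{\mathbf V}=(|V_a|)_{a\in Q_0}$ and $\mathbf 1=(1)_{a\in Q_0}$, and let $N$ be the attaching cardinality matrix of $(Q,V)$. Then $$|\mathsf{EC}|=\overline{\mathbf V}!\,\bigl((I-N)^{-1}\bigr)_{\mathbf 1,\overline{\mathbf V}}.$$ Stated in terms of chains in $\mathbb N^{Q_0}$, $$|\mathsf{EC}|=\sum_{\mathbf\Gamma\in\mathcal C_{\mathbb N^{Q_0}}(\mathbf 1,\overline{\mathbf V})}(-1)^{|\overline V|-|Q_0|-L(\mathbf\Gamma)}\binom{\overline{\mathbf V}}{\mathbf 1,\ \mathbf\Gamma_1-\mathbf 1,\ \ldots,\ \overline{\mathbf V}-\mathbf\Gamma_{L(\mathbf\Gamma)-1}}\prod_{\ell=1}^{L(\mathbf\Gamma)}\mathbf\Gamma_{\ell-1}^{\,\mathsf A(Q)(\mathbf\Gamma_\ell-\mathbf\Gamma_{\ell-1})}.$$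
   Context: A quiver $Q=(Q_0,Q_1)$ is a directed multigraph (loops and parallel arrows allowed) with vertex set $Q_0$ and arrow set $Q_1$; each arrow $\alpha$ has a source $s(\alpha)$ and a target $t(\alpha)$. A path of length $\ell\ge 1$ is a sequence of arrows $p=\alpha_\ell\cdots\alpha_1$ with $t(\alpha_{i-1})=s(\alpha_i)$ for $i=2,\dots,\ell$; its target is $t(\alpha_\ell)$. A sink is a vertex with no outgoing arrow. A set-valued representation of $Q$ on $V$ is a tuple $W=(W_\alpha:V_{s(\alpha)}\to V_{t(\alpha)})_{\alpha\in Q_1}$ of functions; for a path $p=\alpha_\ell\cdots\alpha_1$ put $W_p=W_{\alpha_\ell}\circ\cdots\circ W_{\alpha_1}$. A transversal of $V$ is a subset $C\subseteq\overline V$ containing exactly one element of each $V_a$. $W$ is eventually constant if there is a transversal $C$ such that $W_\alpha(C\cap V_{s(\alpha)})\subseteq C\cap V_{t(\alpha)}$ for every arrow $\alpha$ and, for all paths $p$ longer than some fixed length, $W_p$ maps into $C$ (the first condition is in fact implied by the second under the assumptions on $Q$). Equip $\mathbb N^{Q_0}$ (with $0\in\mathbb N$) with the pointwise partial order. For $\mathbf c,\mathbf d\in\mathbb N^{Q_0}$ put $\mathbf c^{\mathbf d}=\prod_a c_a^{d_a}$ (with $0^0=1$), $\mathbf c!=\prod_a c_a!$, $|\mathbf c|=\sum_a c_a$, and, when $\mathbf c_1+\cdots+\mathbf c_m=\mathbf d$, $\binom{\mathbf d}{\mathbf c_1,\dots,\mathbf c_m}=\frac{\mathbf d!}{\mathbf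 c_1!\cdots\mathbf c_m!}$. The adjacency matrix $\mathsf A(Q)\in\mathbb Z^{Q_0\times Q_0}$ has entry $\mathsf A(Q)_{b,a}$ equal to the number of arrows from $a$ to $b$. The attaching cardinality matrix $N$ is the rational matrix indexed by the interval $[\mathbf 0,\overline{\mathbf V}]\subseteq\mathbb N^{Q_0}$ with $$N_{\mathbf c,\mathbf d}=\frac{(-1)^{|\mathbf d-\mathbf c|-1}}{(\mathbf d-\mathbf c)!}\,\mathbf c^{\,\mathsf A(Q)(\mathbf d-\mathbf c)}\ \text{ if }\mathbf c<\mathbf d,\qquad N_{\mathbf c,\mathbf d}=0\ \text{ otherwise;}$$ it is strictly upper triangular, and $I$ denotes the identity matrix. $\mathcal C_{\mathbb N^{Q_0}}(\mathbf c,\mathbf d)$ is the set of strictly increasing chains $\mathbf\Gamma=(\mathbf\Gamma_0,\dots,\mathbf\Gamma_L)$ in $\mathbb N^{Q_0}$ with $\mathbf\Gamma_0=\mathbf c$, $\mathbf\Gamma_L=\mathbf d$, and $L(\mathbf\Gamma)=L\ge0$ is the length ($L=0$ allowed when $\mathbf c=\mathbf d$). The lower entries of the multinomial coefficient are $\mathbf 1$ followed by the successive differences $\mathbf\Gamma_\ell-\mathbf\Gamma_{\ell-1}$, $\ell=1,\dots,L(\mathbf\Gamma)$ (only $\mathbf 1$ if $L(\mathbf\Gamma)=0$). *)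

(* Defs.v *)
From HB Require Import structures.
From mathcomp Require Import all_boot all_order all_algebra.
From mathcomp Require Import boolp classical_sets cardinality fsbigop.

Set Implicit Arguments.
Unset Strict Implicit.
Unset Printing Implicit Defensive.

Import Order.TTheory GRing.Theory Num.Theory.

Local Open Scope ring_scope.

Record fin_quiver := FinQuiver {
  vertex : finType;
  arrow : finType;
  src : arrow -> vertex;
  tgt : arrow -> vertex }.

(* [path_cons al p] is the path "al p": first [p], then the arrow [al]. *)
Inductive qpath (Q : fin_quiver) : vertex Q -> vertex Q -> Type :=
| path_arrow (al : arrow Q) : qpath (src al) (tgt al)
| path_cons (al : arrow Q) (a : vertex Q) (p : qpath a (src al)) :
    qpath a (tgt al).

Fixpoint path_length (Q : fin_quiver) (a b : vertex Q) (p : qpath a b) : nat :=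
  match p with
  | path_arrow _ => 1%N
  | path_cons _ _ p' => (path_length p').+1
  end.

Definition is_sink (Q : fin_quiver) (a : vertex Q) : Prop :=
  forall al : arrow Q, src al <> a.

(* The sets V_a are made disjoint by tagging: the coproduct of the V_a. *)
Notation coproduct V := {a : _ & V a}.

Section Representations.
Variables (Q : fin_quiver) (V : vertex Q -> finType).

Definition set_rep := {dffun forall al : arrow Q, {ffun V (src al) -> V (tgt al)}}.

Fixpoint rep_path (W : set_rep) (a b : vertex Q) (p : qpath a b) : V a -> V b :=
  match p in qpath a b return V a -> V b with
  | path_arrow al => W al
  | path_cons al _ p' => W al \o rep_path W p'
  end.

Definition transversal (C : {set coproduct V}) : Prop :=
  forall a : vertex Q, exists! v : V a, Tagged V v \in C.

Definition eventually_constant (W : set_rep) : Prop :=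
  exists C : {set coproduct V},
    [/\ transversal C,
        forall (al : arrow Q) (v : V (src al)),
          Tagged V v \in C -> Tagged V (W al v) \in C
      & exists n : nat, forall (a b : vertex Q) (p : qpath a b),
          (n < path_length p)%N ->
          forall v : V a, Tagged V (rep_path W p v) \in C].

Definition EC : {set set_rep} :=
  [set W : set_rep | `[< eventually_constant W >]].

End Representations.

Definition dimvec (Q : fin_quiver) := {ffun vertex Q -> nat}.

Section DimensionVectors.
Variable Q : fin_quiver.
Implicit Types c d : dimvec Q.

Definition lev c d : bool := [forall a, (c a <= d a)%N].
Definition ltv c d : bool := (c != d) && lev c d.
(* Only used when [lev c d], where the subtraction is not truncated. *)
Definition subv d c : dimvec Q := [ffun a => (d a - c a)%N].
Definition expv c d : nat := (\prod_a c a ^ d a)%N.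
Definition factv c : nat := (\prod_a (c a)`!)%N.
Definition normv c : nat := (\sum_a c a)%N.
Definition onev : dimvec Q := [ffun=> 1%N].

Definition multinomv d (cs : seq (dimvec Q)) : rat :=
  (factv d)%:R / (\prod_(c <- cs) factv c)%:R.

Definition adj (b a : vertex Q) : nat :=
  #|[set al : arrow Q | (src al == a) && (tgt al == b)]|.

Definition adj_mulv d : dimvec Q := [ffun b => (\sum_a adj b a * d a)%N].

Definition attach_coef c d : rat :=
  if ltv c d then
    (-1) ^+ (normv (subv d c)).-1 / (factv (subv d c))%:R
      * (expv c (adj_mulv (subv d c)))%:R
  else 0.

(* The vectors between 0 and d. *)
Definition interval d := {dffun forall a : vertex Q, 'I_(d a).+1}.

Definition interval_vec d (i : interval d) : dimvec Q :=
  [ffun a => nat_of_ord (i a)].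

(* The element of [interval d] given by [c], meaningful only if [lev c d]; see
   [interval_vecK]. *)
Definition to_interval d c : interval d := [ffun a => inord (c a)].

Definition attach_mx d : 'M[rat]_#|interval d| :=
  \matrix_(i, j) attach_coef (interval_vec (enum_val i))
                             (interval_vec (enum_val j)).

Definition interval_idx d c : 'I_#|interval d| := enum_rank (to_interval d c).

(* A chain is the sequence of all its terms, the initial one included, so a
   chain of length L has L + 1 terms. *)
Definition chains c d : set (seq (dimvec Q)) :=
  [set G | [/\ (0 < size G)%N, sorted ltv G,
               head c G = c & last c G = d]]%classic.

Definition chain_length (G : seq (dimvec Q)) : nat := (size G).-1.

Definition chain_term (G : seq (dimvec Q)) (l : nat) : dimvec Q :=
  nth onev G l.

Definition chain_diff (G : seq (dimvec Q)) (l : nat) : dimvec Q :=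
  subv (chain_term G l) (chain_term G l.-1).

Definition chain_diffs (G : seq (dimvec Q)) : seq (dimvec Q) :=
  [seq chain_diff G l | l <- iota 1 (chain_length G)].

End DimensionVectors.

Arguments onev Q : clear implicits.

Definition dimV (Q : fin_quiver) (V : vertex Q -> finType) : dimvec Q :=
  [ffun a => #|V a|].

(* The remaining facts show that the totalized operations above are used within
   their range of validity: indices of the matrix, [invmx], sums over chains. *)

Lemma levP (Q : fin_quiver) (c d : dimvec Q) :
  reflect (forall a, (c a <= d a)%N) (lev c d).
Proof. exact: forallP. Qed.

Lemma interval_vecK (Q : fin_quiver) (d c : dimvec Q) :
  lev c d -> interval_vec (enum_val (interval_idx d c)) = c.
Proof.
move=> /levP cd; apply/ffunP => a.
by rewrite enum_rankK !ffunE inordK // ltnS.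
Qed.

Lemma ltv_norm (Q : fin_quiver) (c d : dimvec Q) :
  ltv c d -> (normv c < normv d)%N.
Proof.
case/andP => ncd /levP cd; rewrite ltn_neqAle leq_sum ?andbT //.
apply: contra ncd => /eqP e; apply/eqP/ffunP => a; apply/eqP.
rewrite eqn_leq cd /= -(leq_add2r (\sum_(b | b != a) c b)%N).
have eD (f : dimvec Q) : normv f = (f a + \sum_(b | b != a) f b)%N.
  exact: bigD1.
by rewrite -(eD c) e (eD d) leq_add2l leq_sum.
Qed.

Lemma ltv_trans (Q : fin_quiver) : transitive (@ltv Q).
Proof.
move=> d c e cd de; apply/andP; split.
  by apply: contraTneq (ltn_trans (ltv_norm cd) (ltv_norm de)) => ->; rewrite ltnn.
case/andP: cd => _ /levP cd; case/andP: de => _ /levP de.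
by apply/levP => a; exact: leq_trans (cd a) (de a).
Qed.

Lemma attach_mx_unit (Q : fin_quiver) (d : dimvec Q) :
  1%:M - attach_mx d \in unitmx.
Proof.
rewrite -row_free_unit; apply/inj_row_free => u.
rewrite mulmxBr mulmx1 => /eqP; rewrite subr_eq0 => /eqP uN.
apply/rowP => j; rewrite mxE.
have [n] := ubnP (normv (interval_vec (enum_val j))).
elim: n j => // n IH j lt_j; rewrite uN mxE big1 // => i _.
rewrite mxE /attach_coef; case: ifP => [/ltv_norm lt_ij|]; last by rewrite mulr0.
by rewrite IH ?mul0r // (leq_trans lt_ij).
Qed.

Lemma finite_chains (Q : fin_quiver) (c d : dimvec Q) :
  finite_set (chains c d).
Proof.
pose T := bseq_of #|interval d| (interval d).
pose f (t : T) := [seq interval_vec i | i <- t].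
have /sub_finite_set := finite_image f (finite_finset (X := [set: T]%classic)).
apply=> G [G0 Gs _ Gd].
have Gle : {in G, forall x, lev x d}.
  move: G0 Gs Gd; case/lastP: G => // G y _.
  rewrite sorted_pairwise ?pairwise_rcons; last exact: ltv_trans.
  case/andP=> /allP Gy _; rewrite last_rcons => <- x.
  rewrite mem_rcons inE => /predU1P[->|/Gy /andP[]//].
  by apply/levP => a.
have GK : [seq interval_vec i | i <- map (to_interval d) G] = G.
  rewrite -map_comp -[RHS]map_id; apply/eq_in_map => x /Gle /interval_vecK.
  by rewrite enum_rankK.
have sG : (size (map (to_interval d) G) <= #|interval d|)%N.
  rewrite -(card_uniqP _) ?max_card //; apply: (@map_uniq _ _ (@interval_vec Q d)).
  rewrite GK; apply: sorted_uniq Gs; first exact: ltv_trans.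
  by move=> x; rewrite /ltv eqxx.
by exists (Bseq sG).
Qed.

(* Main.v *)
Require Import Defs.
From mathcomp Require Import all_boot all_order all_algebra.
From mathcomp Require Import boolp classical_sets cardinality fsbigop.
From mathcomp Require Import fintype finset ring.

(** Let [X] be the disjoint union of the [V a], and let a representation [W] act
    on subsets of [X] by sending [S] to the set [step W S] of all [W al v] with
    [v] in [S]. Elements reached by paths of length [n] form the [n]-th iterate
    of [step W], so that [W] is eventually constant exactly when some
    transversal [C] is stable under [step W] and contains an iterate of the whole of [X]
    ([eventually_constantP]). This [C] is unique ([attractor_uniq]): every
    vertex is the target of an arrow, hence each iterate of [X] meets each
    [V a], so two such transversals share an element in each [V a].

    Counting eventually constant representations therefore amounts to counting
    pairs (C, W). This is done on all subsets [S] of [X] at once. Let [F S] be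
    the number of pairs of a transversal [C] inside [S] and a family of maps on
    [S], stable on [S] and on [C], whose iterates of [S] end inside [C]. An
    element of [S] outside [C] with no preimage in [S] can be detached, and
    conversely the elements of [S :\: R] can be attached to a family on [R] by
    choosing, for each arrow leaving them, an arbitrary value in [R]. If
    [S != C], a detachable element exists: otherwise every element of [S]
    outside [C] would have preimages outside [C] of all orders
    ([attracted_surj]). Inclusion-exclusion over the set of detached elements
    gives ([count_attracted_incl_excl])

      sum_(R <= S) (-1)^|S - R| F(R) (dim R)^(A dim(S - R)) = [dim S = 1].

    As there are d! / (c! (d - c)!) subsets of dimension c in a set of dimension
    d ([card_subset_dimset], [factv_bin]), induction on [S] shows that
    F(S) = (dim S)! H(dim S) for any solution H of the triangular system
    [attach_rec],

      H(d) = [d = 1] + sum_c H(c) N_(c,d)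

    ([count_attractedE]). The row of index [onev] of (I - N)^-1 solves this
    system by definition of an inverse ([attach_rec_invmx]). So does the sum of
    the products of entries of N over the chains from [onev] to d, split
    according to the last term but one of the chain ([attach_rec_chains]). Both
    formulas follow by taking S = X. *)

Set Implicit Arguments.
Unset Strict Implicit.
Unset Printing Implicit Defensive.

Import Order.TTheory GRing.Theory Num.Theory.
Local Open Scope ring_scope.

(** * Finite combinatorics *)

(** The sum is the expansion of a product over [T] whose factors are 1 + 0 on
    [U], 1 - 1 on [S :\: U] and 0 + 1 outside [S]: a subset [R] records the
    elements for which the first summand is chosen. *)
Lemma sum_sign_interval (T : finType) (U S : {set T}) : U \subset S ->
  \sum_(R : {set T} | (U \subset R) && (R \subset S)) (-1) ^+ #|S :\: R|
    = (U == S)%:R :> rat.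
Proof.
move=> US.
pose F x : rat := (x \in S)%:R.
pose G x : rat := if x \in U then 0 else if x \in S then -1 else 1.
transitivity (\prod_x (F x + G x)).
  rewrite bigA_distr.
  rewrite [RHS](bigID (fun R : {set T} => (U \subset R) && (R \subset S))) /=.
  rewrite [X in _ + X]big1 ?addr0 => [|R].
    apply: eq_bigr => R /andP[UR RS].
    rewrite -prodr_const [RHS](bigID (mem (S :\: R))) /= [X in _ * X]big1 ?mulr1.
      apply: eq_bigr => x; rewrite inE => /andP[xR xS].
      rewrite (negbTE xR) /G xS; case: ifP => // xU.
      by rewrite (subsetP UR _ xU) in xR.
    move=> x; rewrite inE /F /G negb_and negbK.
    case: (boolP (x \in R)) => [xR _|xR /= xS]; first by rewrite (subsetP RS).
    by case: ifP => [/(subsetP UR)|]; rewrite ?(negbTE xR) // (negbTE xS).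
  rewrite negb_and => /orP[] /subsetPn[x xU xR]; apply/eqP/prodf_eq0; exists x => //.
    by rewrite (negbTE xR) /G xU.
  by rewrite xU /F (negbTE xR).
case: (U =P S) => [eUS|neq].
  by apply: big1 => x _; rewrite /F /G eUS; case: (x \in S); rewrite ?addr0 ?add0r.
have /subsetPn[x xS xU] : ~~ (S \subset U).
  by apply/negP => SU; apply: neq; apply/eqP; rewrite eqEsubset US.
by apply/eqP/prodf_eq0; exists x => //; rewrite /F /G xS (negbTE xU) addrN.
Qed.

Lemma card_familyE (aT : finType) (rT : aT -> finType)
    (F : forall x, pred (rT x)) :
  #|(family F : {pred {dffun forall x, rT x}})| = (\prod_x #|F x|)%N.
Proof. by rewrite card_family foldrE big_map big_enum. Qed.

(** * Representations attracted by a subset *)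
Section Attaching.
Variables (Q : fin_quiver) (V : vertex Q -> finType).
Variable v0 : forall a, V a.
Notation X := (coproduct V).
Notation rep := (set_rep V).
Implicit Types (W Z : rep) (C D R S : {set X}).

Definition step W S : {set X} :=
  [set x | [exists al : arrow Q, [exists v : V (src al),
     (Tagged V v \in S) && (x == Tagged V (W al v))]]].

Lemma stepP W S x :
  reflect (exists (al : arrow Q) (v : V (src al)),
             Tagged V v \in S /\ x = Tagged V (W al v))
          (x \in step W S).
Proof.
rewrite inE; apply: (iffP existsP) => [[al /existsP[v /andP[vS /eqP->]]]|].
  by exists al, v.
by move=> [al [v [vS ->]]]; exists al; apply/existsP; exists v; rewrite vS /=.
Qed.

Lemma stepS W S R : S \subset R -> step W S \subset step W R.
Proof.
move=> SR; apply/subsetP => x /stepP[al [v [vS ->]]]; apply/stepP.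
by exists al, v; split=> //; apply: (subsetP SR).
Qed.

Lemma iter_stepS W n S R :
  S \subset R -> iter n (step W) S \subset iter n (step W) R.
Proof. by move=> SR; elim: n => //= n; apply: stepS. Qed.

Lemma iter_step_closed W n S :
  step W S \subset S -> iter n (step W) S \subset S.
Proof.
by move=> cS; elim: n => //= n IH; apply: subset_trans cS; apply: stepS.
Qed.

Lemma eq_step W Z S :
  (forall al (v : V (src al)), Tagged V v \in S -> W al v = Z al v) ->
  step W S = step Z S.
Proof.
move=> e; apply/setP => x; apply/stepP/stepP=> -[al [v [vS ->]]];
  by exists al, v; rewrite e.
Qed.

Lemma eq_iter_step W Z n S :
  (forall al (v : V (src al)), Tagged V v \in S -> W al v = Z al v) ->
  step W S \subset S -> iter n (step W) S = iter n (step Z) S.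
Proof.
move=> e cS; elim: n => //= n <-; apply: eq_step => al v vS.
by apply: e; apply: subsetP vS; apply: iter_step_closed.
Qed.

(** For [R = D] these are the fibres of the restriction of families of maps from
    [S] to [D]; for [D = set0] and [R = S], the families stable on [S]. *)
Definition fills D S R Z : {pred rep} :=
  family (fun al => [pred f : {ffun V (src al) -> V (tgt al)} |
    f \in family (fun v => if Tagged V v \in D then pred1 (Z al v)
      else if Tagged V v \in S then [pred u | Tagged V u \in R]
      else pred1 (v0 (tgt al)))]).

Lemma fillsP D S R Z W :
  reflect (forall al (v : V (src al)),
            if Tagged V v \in D then W al v == Z al v
            else if Tagged V v \in S then Tagged V (W al v) \in R
            else W al v == v0 _)
          (W \in fills D S R Z).
Proof.
apply: (iffP familyP) => [h al v | h al]; last first.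
  rewrite inE; apply/familyP => v; have := h al v.
  by case: ifP => _; last case: ifP.
have := h al; rewrite inE => /familyP/(_ v).
by case: ifP => _; last case: ifP.
Qed.

Definition dimset S : dimvec Q := [ffun a => #|[set v : V a | Tagged V v \in S]|].

(** Grouping the arrows by target, then by source, turns a product over arrows
    into the monomial c ^ (A d) of the attaching matrix. *)
Lemma expv_arrows (c d : dimvec Q) :
  expv c (adj_mulv d) = (\prod_(al : arrow Q) c (tgt al) ^ d (src al))%N.
Proof.
rewrite (partition_big (@tgt Q) predT) //=; apply: eq_bigr => b _.
have -> : adj_mulv d b = (\sum_(al | tgt al == b) d (src al))%N.
  rewrite ffunE (partition_big (@src Q) predT) //=; apply: eq_bigr => a _.
  rewrite (eq_bigr (fun=> d a)); last by move=> al /andP[_ /eqP->].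
  rewrite sum_nat_const; congr (_ * _)%N.
  by apply: eq_card => al; rewrite !inE andbC.
by rewrite expn_sum; apply: eq_bigr => al /eqP->.
Qed.

Lemma card_fills D S R Z : D \subset S ->
  #|fills D S R Z| = expv (dimset R) (adj_mulv (dimset (S :\: D))).
Proof.
move=> DS; rewrite card_familyE expv_arrows; apply: eq_bigr => al _.
rewrite card_familyE !ffunE -prod_nat_const.
rewrite [LHS](bigID (mem [set v | Tagged V v \in S :\: D])) /=.
rewrite [X in (_ * X)%N]big1 ?muln1.
  apply: eq_bigr => v; rewrite !inE => /andP[/negbTE-> ->].
  by apply: eq_card => u; rewrite !inE.
move=> v; rewrite !inE negb_and negbK; case: ifP => [_ _|_ /negbTE->]; exact: card1.
Qed.

Definition base_rep : rep := [ffun al => [ffun=> v0 (tgt al)]].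

(** The families of maps on [S] that the recursion counts are encoded as total
    representations, equal to the base points outside [S]; this makes a family
    on [S] and its restrictions elements of one type. Agreement with [base_rep]
    on the empty set is no constraint, so the first condition says that [W] maps
    [S] to itself and takes base values elsewhere. *)
Definition attracted C S : {set rep} :=
  [set W in fills set0 S S base_rep |
     (step W C \subset C) && `[< exists n, iter n (step W) S \subset C >]].

Lemma attractedP C S W :
  reflect [/\ forall al (v : V (src al)),
                if Tagged V v \in S then Tagged V (W al v) \in S
                else W al v == v0 _,
              step W C \subset C
            & exists n, iter n (step W) S \subset C]
          (W \in attracted C S).
Proof.
rewrite inE; apply: (iffP and3P) => -[h1 h2 h3]; split=> //.
- move=> al v; have /fillsP/(_ al v) := h1; by rewrite inE.
- exact/asboolP.
- by apply/fillsP => al v; rewrite inE; apply: h1.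
- exact/asboolP.
Qed.

Lemma attracted_step C S W : W \in attracted C S -> step W S \subset S.
Proof.
case/attractedP => h _ _; apply/subsetP => x /stepP[al [v [vS ->]]].
by have := h al v; rewrite vS.
Qed.

(** When the elements of [S :\: R] have no preimage in [S], they can be removed
    without changing whether the iterates end in [C], since one step from [S]
    already lands in [R]. So the restriction to [R] is a surjection whose fibres
    are free choices of values in [R] for the arrows leaving [S :\: R]. *)
Lemma card_attracted_avoid C R S : C \subset R -> R \subset S ->
  #|[set W in attracted C S | step W S \subset R]|
    = (#|attracted C R| * expv (dimset R) (adj_mulv (dimset (S :\: R))))%N.
Proof.
move=> CR RS.
(* Restriction to [R], filled up with base points. *)
pose restr W : rep := [ffun al => [ffun v : V (src al) =>
  if Tagged V v \in R then W al v else v0 _]].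
rewrite -sum1_card (partition_big restr (mem (attracted C R))) /=; last first.
  move=> W; rewrite inE => /andP[/attractedP[h1 h2 [n h3]] WR].
  have eR al (v : V (src al)) : Tagged V v \in R -> W al v = restr W al v.
    by rewrite !ffunE => ->.
  have cR : step W R \subset R := subset_trans (stepS W RS) WR.
  apply/attractedP; split.
  - move=> al v; rewrite !ffunE; case vR: (Tagged V v \in R) => //.
    apply: (subsetP cR).
    by apply/stepP; exists al, v.
  - by rewrite -(@eq_step W) // => al v /(subsetP CR); apply: eR.
  - exists n; rewrite -(@eq_iter_step W) //.
    by apply: subset_trans h3; apply: iter_stepS.
rewrite -sum_nat_const; apply: eq_bigr => Z ZR.
rewrite sum1_card -(card_fills R Z RS); apply: eq_card => W.
rewrite [LHS]inE; case/attractedP: (ZR) => z1 z2 [n z3].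
have cZ := attracted_step ZR.
apply/andP/fillsP => [[] | h].
  rewrite inE => /andP[/attractedP[h1 h2 [m h3]] WR] /eqP rW al v.
  case: ifP => vR; first by rewrite -rW !ffunE vR eqxx.
  have := h1 al v; case: ifP => // vS _; apply: (subsetP WR).
  by apply/stepP; exists al, v.
have eR al (v : V (src al)) : Tagged V v \in R -> Z al v = W al v.
  by move=> vR; have := h al v; rewrite vR => /eqP.
have WR : step W S \subset R.
  apply/subsetP => x /stepP[al [v [vS ->]]]; have := h al v; rewrite vS.
  case: ifP => // vR /eqP->; have := z1 al v; by rewrite vR.
split.
  rewrite inE WR andbT; apply/attractedP; split.
  - move=> al v; have := h al v; case: ifP => vR.
      rewrite (subsetP RS _ vR) => _; apply: (subsetP RS); apply: (subsetP WR).
      by apply/stepP; exists al, v; split=> //; apply: (subsetP RS).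
    by case: ifP => // vS; apply: (subsetP RS).
  - by rewrite -(@eq_step Z) // => al v /(subsetP CR); apply: eR.
  (* The extra step is the one that leads from [S] into [R]. *)
  - exists n.+1; rewrite iterSr; apply: subset_trans z3.
    by rewrite (@eq_iter_step Z W n R) //; apply: iter_stepS.
apply/eqP/ffunP => al; apply/ffunP => v; rewrite !ffunE.
by case: ifP => [/eR->|] // vR; have := z1 al v; rewrite vR => /eqP.
Qed.

(** If each element of [S] outside [C] has a preimage in [S], this preimage is
    again outside [C], as [C] is stable; then [S :\: C] lies in every iterate of
    [S], and one of these is contained in [C]. *)
Lemma attracted_surj C S W : W \in attracted C S -> C \subset S ->
  S \subset C :|: step W S -> C = S.
Proof.
move=> WA CS sur; case/attractedP: (WA) => h1 h2 [n h3].
suff le k : S :\: C \subset iter k (step W) S.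
  apply/eqP; rewrite eqEsubset CS; apply/subsetP => x xS; apply: contraT => xC.
  have xn : x \in iter n (step W) S by apply: (subsetP (le n)); rewrite inE xC.
  by rewrite (subsetP h3) in xC.
elim: k => [|k IH]; first exact: subsetDl.
apply/subsetP => x; rewrite inE => /andP[xC xS].
have := subsetP sur _ xS; rewrite inE (negbTE xC) /= => /stepP[al [v [vS e]]].
apply/stepP; exists al, v; split=> //; apply: (subsetP IH); rewrite inE vS andbT.
apply: contra xC => vC; apply: (subsetP h2); apply/stepP; by exists al, v.
Qed.

(** Summing over [W] first, [sum_sign_interval] keeps the [W] for which
    [C :|: step W S] is all of [S], and [attracted_surj] leaves only [C = S]. *)
Lemma attracted_incl_excl C S : C \subset S ->
  \sum_(R : {set X} | (C \subset R) && (R \subset S)) (-1) ^+ #|S :\: R|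
      * (#|attracted C R| * expv (dimset R) (adj_mulv (dimset (S :\: R))))%:R
    = (#|attracted C S| * (C == S))%:R :> rat.
Proof.
move=> CS.
transitivity (\sum_(R : {set X} | (C \subset R) && (R \subset S))
  \sum_(W in attracted C S) (-1) ^+ #|S :\: R| * (step W S \subset R)%:R : rat).
  apply: eq_bigr => R /andP[CR RS].
  rewrite -card_attracted_avoid // -mulr_sumr; congr (_ * _).
  rewrite -sum1_card natr_sum.
  rewrite (eq_bigl (fun W => (W \in attracted C S) && (step W S \subset R))).
    by rewrite [LHS]big_mkcondr /=; apply: eq_bigr => W _; case: (_ \subset _).
  by move=> W; rewrite inE.
rewrite exchange_big /= -[X in _ = X%:R]sum_nat_const natr_sum.
apply: eq_bigr => W WA.
have US : C :|: step W S \subset S by rewrite subUset CS (attracted_step WA).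
have -> : (C == S) = (C :|: step W S == S).
  apply/eqP/eqP => [e|e]; first by rewrite {1}e; apply/setUidPl/(attracted_step WA).
  by apply: attracted_surj WA CS _; rewrite e.
rewrite -sum_sign_interval //.
rewrite [LHS](bigID (fun R : {set X} => step W S \subset R)) /=.
rewrite [X in _ + X]big1 ?addr0; last by move=> R /andP[_ /negbTE->]; rewrite mulr0.
apply: eq_big => [R|R /andP[_ ->]]; last by rewrite mulr1.
by rewrite subUset andbAC.
Qed.
End Attaching.

(** * Dimension vectors of subsets *)

Section Dims.
Variables (Q : fin_quiver) (V : vertex Q -> finType).
Notation X := (coproduct V).
Implicit Types (C R S : {set X}).

Lemma normv_dimset S : normv (dimset S) = #|S|.
Proof.
rewrite /normv -sum1_card (partition_big (fun x : X => tag x) predT) //=.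
apply: eq_bigr => a _; rewrite ffunE -sum1_card.
have injT : injective (fun v : V a => Tagged V v).
  by move=> v w; apply: eq_from_Tagged.
rewrite !sum1_card -(card_imset _ injT).
apply: eq_card => x; rewrite [RHS]unfold_in.
apply/imsetP/idP => [[v]|/andP[xS /eqP e]].
  by rewrite inE => vS ->; rewrite vS eqxx.
case: x e xS => b v /= e; case: _ / e => vS.
by exists v; rewrite ?inE.
Qed.

Lemma lev_dimset R S : R \subset S -> lev (dimset R) (dimset S).
Proof.
move=> RS; apply/levP => a; rewrite !ffunE; apply: subset_leq_card.
by apply/subsetP => v; rewrite !inE; apply: (subsetP RS).
Qed.

Lemma dimset_setD R S : R \subset S ->
  subv (dimset S) (dimset R) = dimset (S :\: R).
Proof.
move=> RS; apply/ffunP => a; rewrite !ffunE -cardsDS; last first.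
  by apply/subsetP => v; rewrite !inE; apply: (subsetP RS).
by apply: eq_card => v; rewrite !inE.
Qed.

Lemma dimset_proper R S : R \subset S -> ltv (dimset R) (dimset S) = (R != S).
Proof.
move=> RS; rewrite /ltv lev_dimset // andbT; congr (~~ _).
apply/eqP/eqP => [e|-> //]; apply/eqP.
by rewrite eqEcard RS -!normv_dimset e /=.
Qed.

(** A subset of a disjoint union is the same as a family of subsets of the
    summands. *)
Lemma card_subset_dimset S (c : dimvec Q) :
  #|[set R : {set X} | (R \subset S) && (dimset R == c)]|
    = (\prod_a 'C(dimset S a, c a))%N.
Proof.
pose fib R a := [set v : V a | Tagged V v \in R].
pose g R : {dffun forall a, {set V a}} := [ffun a => fib R a].
pose h (f : {dffun forall a, {set V a}}) : {set X} :=
  [set x | tagged x \in f (tag x)].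
have gK : cancel g h by move=> R; apply/setP => -[a v]; rewrite !inE ffunE inE.
have hK : cancel h g.
  by move=> f; apply/ffunP => a; apply/setP => v; rewrite ffunE !inE.
pose F a : pred {set V a} :=
  [pred A : {set V a} | (A \subset fib S a) && (#|A| == c a)].
transitivity #|(family F : {pred {dffun forall a, {set V a}}})|.
  rewrite -[RHS](on_card_preimset (f := g)); last first.
    by exists h => x _; [apply: gK|apply: hK].
  apply: eq_card => R; rewrite !inE; apply/andP/familyP => [[RS /eqP e] a|hF].
    rewrite inE -e !ffunE eqxx andbT; apply/subsetP => v; rewrite !inE.
    exact: (subsetP RS).
  split.
    apply/subsetP => -[a v] vR; have := hF a; rewrite inE => /andP[/subsetP/(_ v)].
    by rewrite ffunE !inE => /(_ vR).
  by apply/eqP/ffunP => a; have := hF a; rewrite !ffunE inE => /andP[_ /eqP].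
rewrite card_familyE; apply: eq_bigr => a _; rewrite ffunE -cards_draws.
by apply: eq_card => A; rewrite !inE.
Qed.

End Dims.

(** * The recursion of the attaching matrix *)

Section Recursion.
Variable Q : fin_quiver.
Implicit Types (c d D : dimvec Q) (H : dimvec Q -> rat).

Definition attach_rec D H := forall d, lev d D ->
  H d = (d == onev Q)%:R
        + \sum_(i : Defs.interval D)
            H (interval_vec i) * attach_coef (interval_vec i) d.

Lemma interval_vec_le D (i : Defs.interval D) : lev (interval_vec i) D.
Proof. by apply/levP => a; rewrite ffunE -ltnS. Qed.

Lemma to_intervalK D c : lev c D -> interval_vec (to_interval D c) = c.
Proof. by move=> /interval_vecK; rewrite enum_rankK. Qed.

Lemma interval_vec_inj D : injective (@interval_vec Q D).
Proof.
move=> i j /ffunP e; apply/ffunP => a; apply: val_inj.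
by have := e a; rewrite !ffunE.
Qed.

Lemma interval_vecE D (i : Defs.interval D) : to_interval D (interval_vec i) = i.
Proof. by apply: interval_vec_inj; rewrite to_intervalK ?interval_vec_le. Qed.

(** This is the row of index [onev] in the identity (I - N)^-1 (I - N) = I. *)
Lemma attach_rec_invmx D : lev (onev Q) D -> attach_rec D (fun d =>
  invmx (1%:M - attach_mx D) (interval_idx D (onev Q)) (interval_idx D d)).
Proof.
move=> leD d dD; set U := invmx _.
have /matrixP/(_ (interval_idx D (onev Q)) (interval_idx D d)) :=
  mulVmx (attach_mx_unit D).
rewrite -/U mulmxBr mulmx1 !mxE => e.
have -> : (d == onev Q) = (interval_idx D (onev Q) == interval_idx D d).
  rewrite (inj_eq enum_rank_inj) -(inj_eq (@interval_vec_inj D)).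
  by rewrite !to_intervalK // eq_sym.
rewrite -e (reindex_onto (@enum_rank (Defs.interval D)) enum_val) /=; last first.
  by move=> i _; rewrite enum_valK.
under [X in _ + X]eq_bigr do rewrite /interval_idx interval_vecE.
under [X in _ - X + _]eq_bigr do rewrite mxE !enum_rankK to_intervalK //.
rewrite [X in _ - X + _](eq_bigl predT) ?subrK // => i.
by rewrite enum_rankK eqxx.
Qed.

Lemma factv_bin c d : lev c d ->
  ((\prod_a 'C(d a, c a)) * (factv c * factv (subv d c)) = factv d)%N.
Proof.
move/levP=> cd; rewrite /factv -!big_split; apply: eq_bigr => a _.
by rewrite ffunE /= bin_fact.
Qed.

Lemma factv_neq0 c : (factv c)%:R != 0 :> rat.
Proof. by rewrite pnatr_eq0 -lt0n prodn_gt0 // => a; apply: fact_gt0. Qed.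

End Recursion.

(** * Counting attracted representations *)

Section Counting.
Variables (Q : fin_quiver) (V : vertex Q -> finType) (v0 : forall a, V a).
Notation X := (coproduct V).
Implicit Types (C R S : {set X}).

(** Summing over the transversals [C] removes the dependence on the position of
    [C] in [S] and leaves a number that is a function of [dimset S] alone. *)
Definition count_attracted S : nat :=
  (\sum_(C : {set X} | (C \subset S) && (dimset C == onev Q))
     #|attracted v0 C S|)%N.

Lemma card_attracted_id C : dimset C = onev Q -> #|attracted v0 C C| = 1%N.
Proof.
move=> C1; transitivity #|fills v0 set0 C C (base_rep v0)|.
  apply: eq_card => W; rewrite !inE andb_idr // => WC.
  have sC : step W C \subset C.
    apply/subsetP => x /stepP[al [v [vC ->]]].
    by have /fillsP/(_ al v) := WC; rewrite inE vC.
  by rewrite sC; apply/asboolP; exists 0%N => /=.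
rewrite card_fills ?sub0set // setD0 C1 expv_arrows big1 // => al _.
by rewrite !ffunE exp1n.
Qed.

Lemma count_attracted_incl_excl S :
  \sum_(R : {set X} | R \subset S) (-1) ^+ #|S :\: R|
      * (count_attracted R * expv (dimset R) (adj_mulv (dimset (S :\: R))))%:R
    = (dimset S == onev Q)%:R :> rat.
Proof.
pose T C := dimset C == onev Q.
transitivity (\sum_(C : {set X} | (C \subset S) && T C)
    \sum_(R : {set X} | (C \subset R) && (R \subset S)) (-1) ^+ #|S :\: R|
      * (#|attracted v0 C R|
         * expv (dimset R) (adj_mulv (dimset (S :\: R))))%:R : rat).
  rewrite (exchange_big_dep (fun R : {set X} => R \subset S)) /=; last first.
    by move=> C R _ /andP[].
  apply: eq_bigr => R RS; rewrite -mulr_sumr; congr (_ * _).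
  rewrite -natr_sum -big_distrl /=; congr ((_ * _)%:R).
  apply: eq_bigl => C; rewrite RS andbT /T andbAC.
  by case CR: (C \subset R); rewrite ?andbF //= (subset_trans CR RS).
under eq_bigr => C /andP[CS _] do rewrite attracted_incl_excl //.
rewrite -natr_sum; congr (_%:R).
rewrite -/(T S); case TS: (T S).
  rewrite (bigD1 S) ?subxx //= eqxx muln1 card_attracted_id; last exact/eqP.
  by rewrite big1 // => C /andP[_ /negbTE->]; rewrite muln0.
rewrite big1 // => C /andP[CS TC]; case: eqP => [e|]; last by rewrite muln0.
by rewrite e TS in TC.
Qed.

(** In the inclusion-exclusion formula, isolate the term [R = S] and group the
    others by c = [dimset R]. By induction each is F(R) = c! H(c), and the
    number d! / (c! (d - c)!) of such [R] produces d! times the entry N_(c,d). *)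
Lemma count_attractedE D H : attach_rec D H -> forall S, lev (dimset S) D ->
  (count_attracted S)%:R = (factv (dimset S))%:R * H (dimset S).
Proof.
move=> Hrec S; have [n] := ubnP #|S|; elim: n S => // n IH S Sn SD.
have := count_attracted_incl_excl S.
rewrite (bigD1 S) //= setDv cards0 expr0 mul1r.
have -> : expv (dimset S) (adj_mulv (dimset (set0 : {set X}))) = 1%N.
  rewrite expv_arrows big1 // => al _; rewrite [dimset set0 _]ffunE.
  by rewrite [X in (_ ^ X)%N]eq_card0 // => v; rewrite !inE.
rewrite muln1 => /(canRL (addrK _)) ->; rewrite Hrec // mulrDr; congr (_ + _).
  case: eqP => [->|]; rewrite ?mulr0 // mulr1 /factv.
  by rewrite big1 // => a _; rewrite ffunE.
rewrite mulr_sumr -sumrN.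
rewrite (partition_big (fun R => to_interval D (dimset R)) predT) //=.
apply: eq_bigr => i _; set c := interval_vec i; set d := dimset S.
have eqi R : R \subset S -> (to_interval D (dimset R) == i) = (dimset R == c).
  move=> RS; rewrite -(inj_eq (@interval_vec_inj _ D)) to_intervalK //.
  apply/levP => a; move/levP: (lev_dimset RS) => le; move/levP: SD => SD.
  by apply: leq_trans (SD a).
rewrite /attach_coef; case: ifP => [lt_cd|nlt]; last first.
  rewrite !mulr0 big1 // => R /andP[/andP[RS nRS]]; rewrite eqi // => /eqP Rc.
  by have := dimset_proper RS; rewrite Rc -/d nlt nRS.
have le_cd : lev c d by case/andP: lt_cd.
pose of_dim_c := [set R : {set X} | (R \subset S) && (dimset R == c)].
rewrite (eq_bigl (fun R => R \in of_dim_c)); last first.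
  move=> R; rewrite !inE; case RS: (R \subset S) => //=.
  rewrite eqi // andb_idl //.
  by move=> /eqP Rc; rewrite -dimset_proper // Rc.
rewrite (eq_bigr (fun=> (-1) ^+ (normv (subv d c)).-1 * (factv c)%:R * H c
   * (expv c (adj_mulv (subv d c)))%:R)); last first.
  move=> R; rewrite inE => /andP[RS /eqP Rc].
  have RnS : R != S by rewrite -dimset_proper // Rc.
  have gt0 : (0 < #|S :\: R|)%N.
    by rewrite cardsDS // subn_gt0 proper_card // properEneq RnS.
  rewrite natrM IH ?Rc //; first last.
  - exact: interval_vec_le.
  - by rewrite -ltnS (leq_trans _ Sn) // ltnS proper_card // properEneq RnS.
  rewrite -dimset_setD // Rc -(normv_dimset (S :\: R)) -dimset_setD // Rc.
  rewrite -/d -[in LHS](@prednK (normv (subv d c))); last first.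
    by rewrite -Rc dimset_setD // normv_dimset.
  by rewrite exprS mulN1r mulNr opprK !mulrA.
rewrite sumr_const card_subset_dimset -/d -(factv_bin le_cd) !natrM -[LHS]mulr_natl.
rewrite -!mulrA; congr (_ * _).
by field; apply: factv_neq0.
Qed.
End Counting.

(** * Eventually constant representations *)

Section EventuallyConstant.
Variables (Q : fin_quiver) (V : vertex Q -> finType) (v0 : forall a, V a).
Notation X := (coproduct V).
Implicit Types (W : set_rep V) (C S : {set X}).

Lemma rep_path_iter_step W S a b (p : qpath a b) (v : V a) :
  Tagged V v \in S ->
  Tagged V (rep_path W p v) \in iter (path_length p) (step W) S.
Proof.
elim: p v => [al|al c p IH] v vS /=; apply/stepP; first by exists al, v.
by exists al, (rep_path W p v); split=> //; apply: IH.
Qed.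

Lemma iter_step_rep_path W S n x : x \in iter n.+1 (step W) S ->
  exists (a b : vertex Q) (p : qpath a b) (v : V a),
    [/\ path_length p = n.+1, Tagged V v \in S & x = Tagged V (rep_path W p v)].
Proof.
elim: n x => [|n IH] x /stepP[al [v [vS ->]]].
  by exists (src al), (tgt al), (path_arrow al), v.
have [a [b [p [u [lp uS e]]]]] := IH _ vS.
have eb : b = src al by rewrite -[LHS](congr1 tag e).
subst b; exists a, (tgt al), (path_cons p), u; split=> //=; first by rewrite lp.
by rewrite (eq_from_Tagged e).
Qed.

Lemma transversalP C : Defs.transversal C <-> dimset C = onev Q.
Proof.
split=> [tC|/ffunP e a].
  apply/ffunP => a; have [v [vC uv]] := tC a; rewrite !ffunE; apply/eqP/cards1P.
  exists v; apply/setP => w; rewrite !inE; apply/idP/eqP => [/uv->|->] //.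
have := e a; rewrite !ffunE => /eqP/cards1P[v /setP ev].
exists v; split; first by have := ev v; rewrite !inE eqxx.
by move=> w wC; have := ev w; rewrite !inE wC => /esym/eqP.
Qed.

(** Elements reached by paths of length [n] are the elements of the [n]-th
    iterate of the whole set, and stability of [C] propagates an inclusion of
    one iterate in [C] to all later ones. *)
Lemma eventually_constantP W :
  eventually_constant W <->
  exists2 C : {set X}, dimset C = onev Q & W \in attracted v0 C [set: X].
Proof.
split=> [[C [tC cC [n nC]]]|[C C1 /attractedP[_ cC [n nC]]]].
  exists C; first exact/transversalP.
  apply/attractedP; split.
  - by move=> al v; rewrite !inE.
  - by apply/subsetP => x /stepP[al [v [vC ->]]]; apply: cC.
  - exists n.+1; apply/subsetP => x /iter_step_rep_path[a [b [p [v [lp _ ->]]]]].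
    by apply: nC; rewrite lp.
exists C; split; first exact/transversalP.
  by move=> al v vC; apply: (subsetP cC); apply/stepP; exists al, v.
exists n => a b p np v; have vT : Tagged V v \in [set: X] by rewrite inE.
apply: (subsetP _ _ (rep_path_iter_step W p vT)).
rewrite -(subnK (ltnW np)) iterD.
exact: subset_trans (iter_stepS _ _ nC) (iter_step_closed _ cC).
Qed.

Hypothesis has_pred : forall a, exists al : arrow Q, tgt al = a.

Lemma iter_step_surj W n a :
  exists v : V a, Tagged V v \in iter n (step W) [set: X].
Proof.
elim: n a => [|n IH] a; first by exists (v0 a); rewrite inE.
have [al <-] := has_pred a; have [v vn] := IH (src al).
by exists (W al v); apply/stepP; exists al, v.
Qed.

(** Both transversals contain a common iterate of the whole set, which by
    [iter_step_surj] has an element in each [V a]; a transversal has only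
    one. *)
Lemma attractor_uniq W C C' : dimset C = onev Q -> dimset C' = onev Q ->
  W \in attracted v0 C [set: X] -> W \in attracted v0 C' [set: X] -> C = C'.
Proof.
move: C C'.
suff sub C C' : dimset C = onev Q -> dimset C' = onev Q ->
  W \in attracted v0 C [set: X] -> W \in attracted v0 C' [set: X] ->
  C \subset C'.
  by move=> C C' ? ? ? ?; apply/eqP; rewrite eqEsubset !sub.
move=> /transversalP tC _ /attractedP[_ cC [n nC]] /attractedP[_ cC' [m mC]].
apply/subsetP => -[a v] vC.
have [u uN] := iter_step_surj W (m + n) a.
have uC : Tagged V u \in C.
  apply: (subsetP _ _ uN); rewrite iterD.
  exact: subset_trans (iter_stepS _ _ nC) (iter_step_closed _ cC).
have uC' : Tagged V u \in C'.
  apply: (subsetP _ _ uN); rewrite addnC iterD.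
  exact: subset_trans (iter_stepS _ _ mC) (iter_step_closed _ cC').
have [w [_ wu]] := tC a.
by rewrite -[v](wu v vC) (wu u uC).
Qed.

(** Each eventually constant [W] is attracted by exactly one transversal, so it
    is counted once in the sum over transversals. *)
Lemma card_EC : #|EC V| = count_attracted v0 [set: X].
Proof.
rewrite -sum1_card /count_attracted.
transitivity (\sum_(W in EC V)
  \sum_(C : {set X} | (dimset C == onev Q) && (W \in attracted v0 C [set: X])) 1)%N.
  apply: eq_bigr => W; rewrite inE => /asboolP/eventually_constantP[C C1 WC].
  rewrite (big_pred1 C) // => C'; apply/andP/eqP => [[/eqP C1' WC']|->].
    exact: attractor_uniq WC' WC.
  by rewrite C1 eqxx.
rewrite (exchange_big_dep (fun C : {set X} => dimset C == onev Q)) /=; last first.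
  by move=> W C _ /andP[].
rewrite [RHS](eq_bigl (fun C => dimset C == onev Q)) => [|C]; last by rewrite subsetT.
apply: eq_bigr => C C1; rewrite sum1_card; apply: eq_card => W.
rewrite [LHS]unfold_in /= C1 /= andb_idl // => WC; rewrite inE; apply/asboolP.
by apply/eventually_constantP; exists C => //; apply/eqP.
Qed.

End EventuallyConstant.

(** * Chains of dimension vectors *)

Section Chains.
Variable Q : fin_quiver.
Implicit Types (c d D : dimvec Q) (G : seq (dimvec Q)).

(** The term contributed by a chain in the expansion of (I - N)^-1 as the sum of
    the powers of N. *)
Definition chain_weight G : rat :=
  \prod_(1 <= l < (chain_length G).+1)
    attach_coef (chain_term G l.-1) (chain_term G l).

Lemma chain_weight_rcons G d : (0 < size G)%N ->
  chain_weight (rcons G d) = chain_weight G * attach_coef (last d G) d.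
Proof.
case: G => // z s _; rewrite /chain_weight /chain_length /= size_rcons.
rewrite big_nat_recr //=; congr (_ * _).
  apply: eq_big_nat => l /andP[l0 ls].
  rewrite /chain_term -rcons_cons !nth_rcons /= ls.
  by rewrite (leq_ltn_trans (leq_pred l)).
rewrite /chain_term -rcons_cons !nth_rcons /= ltnn eqxx ltnSn.
rewrite -[last z s]/(last z (z :: s)) -nth_last /=; congr attach_coef.
exact: set_nth_default.
Qed.

Definition chain_seq c d   : seq (seq (dimvec Q)) :=
  finmap.enum_fset (fset_set (chains c d)).

Lemma mem_chain_seq c d G : (G \in chain_seq c d) = `[< chains c d G >].
Proof.
have -> : (G \in chain_seq c d) = (G \in chains c d).
  exact: (in_fset_set (finite_chains c d)).
by apply/idP/asboolP => [/set_mem|/mem_set].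
Qed.

Lemma chain_seq_uniq c d : uniq (chain_seq c d).
Proof. exact: finmap.fset_uniq. Qed.

Lemma chains_rcons c d G :
  chains c d G <-> (c == d /\ G = [:: c]) \/
    exists G' e, [/\ chains c e G', ltv e d & G = rcons G' d].
Proof.
split=> [[]|[[/eqP<- ->]|[G' [e [[G0 Gs Gc Ge] ed ->]]]]]; last first.
- case: G' G0 Gs Gc Ge => // z s _ /= Gs Gc Ge.
  by split; rewrite //= ?last_rcons // rcons_path Gs Ge.
- by split.
case/lastP: G => // G y _; rewrite last_rcons; case: G => [|z s] /=.
  by move=> _ -> ->; left; rewrite eqxx.
rewrite rcons_path => /andP[zs lt_y] zc yd; right; exists (z :: s), (last z s).
by rewrite -yd; split.
Qed.

(** A chain ending at [d] is either reduced to its initial term or obtained by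
    appending [d] to a chain ending strictly below it. The vectors below [d]
    are enumerated by the index type of the attaching matrix, so that the
    resulting sum is literally the one in [attach_rec]. *)
Lemma perm_chain_seq D c d : lev d D ->
  perm_eq (chain_seq c d)
    ((if d == c then [:: [:: c]] else [::]) ++
     [seq rcons G d | i : Defs.interval D <-
                        [seq i <- enum (Defs.interval D) |
                          ltv (interval_vec i) d],
                      G <- chain_seq c (interval_vec i)]).
Proof.
move=> dD; apply: uniq_perm; first exact: chain_seq_uniq.
  rewrite cat_uniq; apply/and3P; split; first by case: eqP.
    apply/hasPn => G /allpairsPdep[i [G' [_ G'c ->]]].
    case: eqP => //= _; rewrite inE; apply/eqP => /(congr1 size).
    rewrite size_rcons /= => -[] /eqP; rewrite size_eq0 => /eqP G'0.
    by move: G'c; rewrite mem_chain_seq G'0 => /asboolP[].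
  apply: allpairs_uniq_dep.
  - by rewrite filter_uniq ?enum_uniq.
  - by move=> i _; apply: chain_seq_uniq.
  - move=> _ _ /allpairsPdep[i [G [_ Gi ->]]] /allpairsPdep[j [H [_ Hj ->]]] /=.
    move/rcons_inj => [e]; move: Gi Hj; rewrite -e !mem_chain_seq.
    move=> /asboolP[_ _ _ li] /asboolP[_ _ _ lj].
    suff -> : i = j by [].
    by apply: (@interval_vec_inj Q D); rewrite -li -lj.
move=> G; rewrite mem_chain_seq mem_cat.
apply/asboolP/orP => [/chains_rcons[[/eqP-> ->]|[G' [e [G'c ed ->]]]]|].
- by left; rewrite eqxx mem_head.
- right; have eD : lev e D.
    apply/levP => a; move/levP: dD => dD; case/andP: ed => _ /levP ed.
    exact: leq_trans (dD a).
  apply/allpairsPdep; exists (to_interval D e), G'.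
  rewrite mem_filter to_intervalK // ed mem_enum mem_chain_seq.
  by split=> //; apply/asboolP.
case=> [Gc|/allpairsPdep[i [G' [iI G'c ->]]]]; apply/chains_rcons.
  by left; case: eqP Gc => // ->; rewrite inE => /eqP->.
right; exists G', (interval_vec i); split=> //.
  by apply/asboolP; rewrite -mem_chain_seq.
by move: iI; rewrite mem_filter => /andP[].
Qed.

Lemma attach_rec_chains D :
  attach_rec D (fun d => \sum_(G \in chains (onev Q) d) chain_weight G).
Proof.
have sumE d : \sum_(G \in chains (onev Q) d) chain_weight G
    = \sum_(G <- chain_seq (onev Q) d) chain_weight G.
  by rewrite fsbig_finite //; apply: finite_chains.
move=> d dD; rewrite sumE (perm_big _ (perm_chain_seq (onev Q) dD)) big_cat /=.
congr (_ + _).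
  case: eqP => _; rewrite ?big_nil // big_seq1 /chain_weight big_geq //.
rewrite big_allpairs_dep big_filter big_enum_cond /= [LHS]big_mkcond /=.
apply: eq_bigr => i _; case: ifP => [lt_id|nlt]; last by rewrite /attach_coef nlt mulr0.
rewrite sumE mulr_suml big_seq [RHS]big_seq; apply: eq_bigr => G.
rewrite mem_chain_seq => /asboolP[G0 _ _ Gl]; rewrite chain_weight_rcons //.
by case: G G0 Gl => //= z s _ ->.
Qed.

Lemma normv_subv c d : lev c d -> (normv (subv d c) + normv c = normv d)%N.
Proof.
move/levP=> cd; rewrite /normv -big_split; apply: eq_bigr => a _.
by rewrite ffunE /= subnK.
Qed.

Lemma chain_term_ltv G l : sorted (@ltv Q) G -> (l < chain_length G)%N ->
  ltv (chain_term G l) (chain_term G l.+1).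
Proof. by move=> /(sortedP (onev Q)) Gs lG; apply: Gs; rewrite -ltn_predRL. Qed.

(** The exponents telescope, each step of the chain costing one more unit. The
    exponent on the right is kept an integer to avoid truncated subtraction. *)
Lemma chain_signE c d G : chains c d G -> forall k, (k <= chain_length G)%N ->
  \prod_(1 <= l < k.+1) (-1) ^+ (normv (chain_diff G l)).-1
    = (-1) ^ ((normv (chain_term G k))%:Z - (normv c)%:Z - k%:Z) :> rat.
Proof.
move=> [G0 Gs Gc _]; elim=> [|k IH] kG.
  rewrite big_geq // subr0.
  have -> : chain_term G 0 = c.
    by rewrite -[RHS]Gc /chain_term; case: G G0 {Gs Gc kG}.
  by rewrite subrr.
have lt_k := chain_term_ltv Gs kG; rewrite big_nat_recr //= IH 1?ltnW //.
rewrite /chain_diff /=; set x := chain_term G k; set y := chain_term G k.+1.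
have le_xy : lev x y by case/andP: lt_k.
have yx := normv_subv le_xy.
have gt0 : (0 < normv (subv y x))%N.
  by rewrite -(ltn_add2r (normv x)) yx add0n ltv_norm.
rewrite -yx exprnP -expfzDr //; congr (_ ^ _).
rewrite -{2}(prednK gt0) !PoszD -addn1 -(addn1 k) !PoszD; ring.
Qed.

Lemma chain_weightE c d G : chains c d G ->
  chain_weight G = (-1) ^ ((normv d)%:Z - (normv c)%:Z - (chain_length G)%:Z)
    / (\prod_(e <- chain_diffs G) factv e)%:R
    * \prod_(1 <= l < (chain_length G).+1)
        (expv (chain_term G l.-1) (adj_mulv (chain_diff G l)))%:R.
Proof.
move=> Gcd; have [G0 Gs Gc Gd] := Gcd.
have <- : chain_term G (chain_length G) = d.
  by rewrite -[RHS]Gd -nth_last; apply: set_nth_default; rewrite prednK.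
rewrite -(chain_signE Gcd) // /chain_diffs big_map natr_prod -prodfV.
have -> : iota 1 (chain_length G) = index_iota 1 (chain_length G).+1.
  by rewrite /index_iota subn1.
rewrite -!big_split; apply: eq_big_nat => -[|l] // /andP[_ lG].
by rewrite /attach_coef chain_term_ltv.
Qed.
End Chains.

(** * The two formulas *)

Theorem theorem4p8 (Q : fin_quiver) (V : vertex Q -> finType)
  (no_sinks : forall a : vertex Q, ~ is_sink a)
  (long_paths : forall a : vertex Q, exists (b : vertex Q) (p : qpath b a),
      (#|vertex Q| <= path_length p)%N)
  (V_nonempty : forall a : vertex Q, (0 < #|V a|)%N) :
  (#|EC V|)%:R
    = (factv (dimV V))%:R
      * (invmx (1%:M - attach_mx (dimV V)))
          (interval_idx (dimV V) (onev Q)) (interval_idx (dimV V) (dimV V))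
  /\
  (#|EC V|)%:R
    = \sum_(G \in chains (onev Q) (dimV V))
        (-1) ^ (#|{: coproduct V}|%:Z - #|vertex Q|%:Z - (chain_length G)%:Z)
        * multinomv (dimV V) (onev Q :: chain_diffs G)
        * \prod_(1 <= l < (chain_length G).+1)
            (expv (chain_term G l.-1) (adj_mulv (chain_diff G l)))%:R
    :> rat.
Proof.
have v0 a : V a by have /card_gt0P/sigW[v _] := V_nonempty a.
have has_pred a : exists al : arrow Q, tgt al = a.
  by have [b [p _]] := long_paths a; case: p => [al|al c p]; exists al.
have dimT : dimset [set: coproduct V] = dimV V.
  by apply/ffunP => a; rewrite !ffunE; apply: eq_card => v; rewrite !inE.
have leDD : lev (dimV V) (dimV V) by apply/levP.
have main H : attach_rec (dimV V) H ->
    (#|EC V|)%:R = (factv (dimV V))%:R * H (dimV V) :> rat.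
  by move=> /(count_attractedE v0) e; rewrite (card_EC v0) // e dimT.
split.
  apply: main (attach_rec_invmx _); apply/levP => a; rewrite !ffunE.
  exact: V_nonempty.
rewrite (main _ (@attach_rec_chains Q (dimV V))) mulr_fsumr.
apply: eq_fsbigr => G /set_mem Gc.
rewrite (chain_weightE Gc) -dimT normv_dimset cardsT.
have -> : normv (onev Q) = #|vertex Q|.
  by rewrite /normv -sum1_card; apply: eq_bigr => a _; rewrite ffunE.
have f1 : factv (onev Q) = 1%N by rewrite /factv big1 // => a _; rewrite ffunE.
rewrite /multinomv big_cons f1 mul1n !mulrA; congr (_ * _ * _).
by rewrite mulrC.
Qed.
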